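(* In the setting of the context, let $c\in(0,\nu/(2\delta))$ and let $0<\mu<\frac{1-\sigma_{\max}}{\delta}$. Then there exists $\rho>0$ such that, with $$\nu_\rho=\min\Big\{\nu-2\delta c,\ \frac{\rho\,\underline\sigma\,c^2}{4(c^2+1)}\Big\}>0,$$ the following holds for every $\alpha$ with $$0<\alpha\le\min\{1,\ \mu\nu_\rho(2-\sigma_{\max}-\mu\delta)\}.$$ Put $$\gamma=\max\Big\{\big(1-\mu\nu_\rho(2-\sigma_{\max}-\mu\delta)\big)/(1-\alpha\sigma_{\max}),\ 1-\alpha\underline\sigma\Big\}.$$ Then $\gamma<1$, and for every sequence $(\mathbf w_i,\mathbf y_i,\mathbf z_i)$ generated by the recursion in the context with $\mathbf y_0=0$ (and arbitrary $\mathbf w_0$) there is a constant $C>0$ such that $$\|\mathbf w_i-\mathbf w^\star\|^2\le C\gamma^i\qquad\text{for all } i\ge0.$$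
   Context: Setting. $J_1,\dots,J_K:\mathbb R^M\to\mathbb R$ ($K\ge2$) are convex and differentiable with $\|\nabla J_k(u)-\nabla J_k(v)\|\le\delta\|u-v\|$ for all $u,v$; $\bar J(w)=\frac1K\sum_{k=1}^K J_k(w)$ satisfies $(u-v)^{\top}(\nabla\bar J(u)-\nabla\bar J(v))\ge\nu\|u-v\|^2$ for all $u,v$, with $0<\nu\le\delta$. $R:\mathbb R^M\to\mathbb R\cup\{\infty\}$ is proper, lower-semicontinuous and convex. The problem $\min_{w\in\mathbb R^M}\frac1K\sum_k J_k(w)+R(w)$ has a (necessarily unique) solution $w^\star$, and $\mathbf w^\star=\mathbf 1_K\otimes w^\star$, where $\mathbf 1_K$ is the all-ones vector of size $K$ and $\otimes$ is the Kronecker product. $A\in\mathbb R^{K\times K}$ is symmetric, doubly stochastic (nonnegative entries, $A\mathbf 1_K=\mathbf 1_K$ and $\mathbf 1_K^{\top}A=\mathbf 1_K^{\top}$) and primitive (some power $A^p$ has all entries positive). $\mathcal B=\frac12(I_{KM}-A\otimes I_M)$ is symmetric positive semidefinite with eigenvalues in $[0,1)$; $\mathcal B^{1/2}$ is its positive semidefinite square root; $\sigma_{\max}$ is the largest singular value of $\mathcal B$ and $\underline\sigma$ its smallest nonzero singular value, so $0<\underline\sigma\le\sigma_{\max}<1$. For $\mathbf w=\mathrm{col}\{w_1,\dots,w_K\}\in\mathbb R^{KM}$ (the vector stacking $w_1,\dots,w_K\in\mathbb R^M$): $\mathcal J(\mathbf w)=\sum_k J_k(w_k)$, $\mathcal R(\mathbf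 w)=\sum_k R(w_k)$, $\mathcal J_\mu(\mathbf w)=\mathcal J(\mathbf w)+\frac1{2\mu}\|\mathcal B^{1/2}\mathbf w\|^2$. Notation: $\mathrm{prox}_{\mu f}(x)=\arg\min_z\{f(z)+\frac1{2\mu}\|z-x\|^2\}$. Recursion (proximal primal-dual diffusion, P2D2), with primal step-size $\mu$ and dual step-size $\alpha$: from initial $\mathbf w_0,\mathbf y_0\in\mathbb R^{KM}$, for $i\ge1$, $$\mathbf z_i=\mathbf w_{i-1}-\mu\nabla\mathcal J_\mu(\mathbf w_{i-1})-\mathcal B^{1/2}\mathbf y_{i-1},\quad \mathbf y_i=\mathbf y_{i-1}+\alpha\mathcal B^{1/2}\mathbf z_i,\quad \mathbf w_i=\mathrm{prox}_{\mu\mathcal R}(\mathbf z_i).$$ *)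

(* Defs.v *)
From HB Require Import structures.
From mathcomp Require Import all_boot all_order all_algebra.
From mathcomp Require Import mxtens.
From mathcomp Require Import all_classical all_reals all_analysis.
Set Implicit Arguments.
Unset Strict Implicit.
Unset Printing Implicit Defensive.
Import Order.TTheory GRing.Theory Num.Theory.
Import numFieldNormedType.Exports.
Local Open Scope classical_set_scope.
Local Open Scope ring_scope.

(* The library norm on matrices is the sup norm, so the Euclidean structure is
   introduced separately; the topology, hence differentiability and
   semicontinuity, is the same for both norms. *)
Definition dotp (R : realType) (n : nat) (u v : 'cV[R]_n) : R := (u^T *m v) 0 0.

Definition enorm (R : realType) (n : nat) (u : 'cV[R]_n) : R :=
  Num.sqrt (dotp u u).

Definition grad (R : realType) (n : nat) (f : 'cV[R]_n -> R^o) (x : 'cV[R]_n) :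
    'cV[R]_n :=
  \col_(i < n) 'D_(delta_mx i 0) f x.

Definition argmin (R : realType) (T : Type) (f : T -> \bar R) : set T :=
  [set x | forall y, (f x <= f y)%E].

(* Functions into R U {+oo} are [\bar R]-valued and never [-oo]. *)
Definition proper_ext (R : realType) (T : Type) (f : T -> \bar R) : Prop :=
  (forall x, f x != -oo%E) /\ (exists x, f x != +oo%E).

Definition convex_ext (R : realType) (n : nat) (f : 'cV[R]_n -> \bar R) : Prop :=
  forall (x y : 'cV[R]_n) (t : R), 0 <= t -> t <= 1 ->
    (f (t *: x + (1 - t) *: y)%R <= t%:E * f x + (1 - t)%:E * f y)%E.

(* [p = prox_{mu f}(x)] is written [prox mu f x p]: the argmin is kept as a set,
   which for proper convex [f] and [0 < mu] has at most one element. *)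
Definition prox (R : realType) (n : nat) (mu : R) (f : 'cV[R]_n -> \bar R)
    (x : 'cV[R]_n) : set 'cV[R]_n :=
  argmin (fun z => (f z + ((2 * mu)^-1 * enorm (z - x) ^+ 2)%:E)%E).

Definition doubly_stochastic (R : realType) (K : nat) (A : 'M[R]_K) : Prop :=
  [/\ forall i j, 0 <= A i j,
      A *m const_mx 1 = const_mx 1 :> 'cV[R]_K &
      const_mx 1 *m A = const_mx 1 :> 'rV[R]_K].

Definition primitive (R : realType) (K : nat) (A : 'M[R]_K) : Prop :=
  exists p : nat, forall i j, 0 < (A ^+ p) i j.

Definition psd (R : realType) (n : nat) (P : 'M[R]_n) : Prop :=
  P^T = P /\ forall x : 'cV[R]_n, 0 <= dotp x (P *m x).

Definition psd_sqrt (R : realType) (n : nat) (P S : 'M[R]_n) : Prop :=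
  psd S /\ S *m S = P.

Definition singular_values (R : realType) (n : nat) (P : 'M[R]_n) : set R :=
  [set s | 0 <= s /\ eigenvalue (P^T *m P) (s ^+ 2)].

Definition largest_singular_value (R : realType) (n : nat) (P : 'M[R]_n)
    (s : R) : Prop :=
  singular_values P s /\ forall t, singular_values P t -> t <= s.

Definition smallest_nonzero_singular_value (R : realType) (n : nat)
    (P : 'M[R]_n) (s : R) : Prop :=
  [/\ singular_values P s, s != 0 &
      forall t, singular_values P t -> t != 0 -> s <= t].

Definition Jbar (R : realType) (K M : nat) (J : 'I_K -> 'cV[R]_M -> R)
    (w : 'cV[R]_M) : R :=
  K%:R^-1 * \sum_(k < K) J k w.

(* A vector of R^{KM} is indexed as in the Kronecker product [*t]: entry [j] of
   its [k]-th block of size [M] sits at position [k * M + j]. *)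
Definition block (R : realType) (K M : nat) (k : 'I_K) (w : 'cV[R]_(K * M)) :
    'cV[R]_M :=
  \col_(j < M) w (mxtens_index (k, j)) 0.

Definition Jcal (R : realType) (K M : nat) (J : 'I_K -> 'cV[R]_M -> R)
    (w : 'cV[R]_(K * M)) : R :=
  \sum_(k < K) J k (block k w).

Definition Rcal (R : realType) (K M : nat) (r : 'cV[R]_M -> \bar R)
    (w : 'cV[R]_(K * M)) : \bar R :=
  (\sum_(k < K) r (block k w))%E.

Definition Bcal (R : realType) (K M : nat) (A : 'M[R]_K) : 'M[R]_(K * M) :=
  2^-1 *: (1%:M - tensmx A (1%:M : 'M[R]_M)).

Definition Jmu (R : realType) (K M : nat) (J : 'I_K -> 'cV[R]_M -> R)
    (Bh : 'M[R]_(K * M)) (mu : R) (w : 'cV[R]_(K * M)) : R :=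
  Jcal J w + (2 * mu)^-1 * enorm (Bh *m w) ^+ 2.

(* [Bh] stands for [Bcal^{1/2}]; the value [z 0] is irrelevant. *)
Definition P2D2 (R : realType) (K M : nat) (J : 'I_K -> 'cV[R]_M -> R)
    (r : 'cV[R]_M -> \bar R) (Bh : 'M[R]_(K * M)) (mu alpha : R)
    (w y z : nat -> 'cV[R]_(K * M)) : Prop :=
  forall i : nat,
    [/\ z i.+1 = w i - mu *: grad (Jmu J Bh mu) (w i) - Bh *m y i,
        y i.+1 = y i + alpha *: (Bh *m z i.+1) &
        prox mu (@Rcal R K M r) (z i.+1) (w i.+1)].

(* Main.v *)
Require Import Defs.
From HB Require Import structures.
From mathcomp Require Import all_boot all_order all_algebra.
From mathcomp Require Import mxtens.
From mathcomp Require Import all_classical all_reals all_analysis.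
From mathcomp Require Import ring lra.
Set Implicit Arguments.
Unset Strict Implicit.
Unset Printing Implicit Defensive.
Import Order.TTheory GRing.Theory Num.Theory.
Import numFieldNormedType.Exports.
Local Open Scope classical_set_scope.
Local Open Scope ring_scope.

(** The recursion has a fixed point, and a weighted sum of the squared primal and
    dual errors with respect to it decreases by the factor [gamma] at each step.

    Fixed point. Fermat's rule at [wstar] gives that minus the gradient of the
    mean cost is a subgradient of [r] there, so the consensus vector of
    [wstar - mu * grad Jbar wstar] is mapped by the proximal step to the consensus
    vector of [wstar] ([zstar_subgradient]). Its difference with the gradient step
    taken at consensus has blocks of zero sum. By primitivity the kernel of [B]
    is the consensus space ([ker_Bcal]), so such a vector is in the range of [B]
    and is produced by a dual variable in the range of [B^{1/2}]
    ([dual_fixed_point]). Since [y_0 = 0], all dual errors stay in that range,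
    where [B >= smin].

    One step. The cross terms of the primal and dual updates cancel
    ([primal_dual_identity]). What remains on the dual side is contracted by
    [1 - alpha * smin], by the spectral bound [sqrt_lower]. On the primal side
    there is a gradient step for [J_mu], whose gradient is cocoercive with constant
    [delta + smax / mu] ([grad_cocoercive], [cocoerciveD], [sqrt_upper]) and
    strongly monotone with respect to the fixed point
    ([restricted_strong_monotonicity]); it contracts by
    [1 - mu * nu_rho * (2 - smax - mu * delta)]. The proximal step does not
    increase distances ([subgradient_nonexpansive]), and passing from
    [|z|^2 - alpha |B^{1/2} z|^2] to [|z|^2] costs the factor [1 - alpha * smax].

    Choice of [rho]. Each local cost is merely convex, so strong monotonicity
    comes from the mean cost on the consensus part of the error and from the
    penalty [B / mu] on the rest, with some constant [m > 0]. The second term of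
    the minimum defining [nu_rho] is proportional to [rho], and [rho] is chosen to
    make it equal to [m], so that [nu_rho <= m].

    The bounds in terms of singular values rest on [rayleigh_min]: the minimum of
    a Rayleigh quotient over an invariant subspace is an eigenvalue. *)

(** * The Euclidean inner product *)

Section InnerProduct.
Variables (R : realType) (n : nat).
Implicit Types (u v w : 'cV[R]_n).

Lemma dotpE u v : dotp u v = \sum_(i < n) u i 0 * v i 0.
Proof. by rewrite /dotp mxE; apply: eq_bigr => i _; rewrite mxE. Qed.

Lemma dotpC u v : dotp u v = dotp v u.
Proof. by rewrite !dotpE; apply: eq_bigr => i _; rewrite mulrC. Qed.

Lemma dotpDr u v w : dotp u (v + w) = dotp u v + dotp u w.
Proof. by rewrite /dotp mulmxDr mxE. Qed.

Lemma dotpZr a u v : dotp u (a *: v) = a * dotp u v.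
Proof. by rewrite /dotp -scalemxAr mxE. Qed.

Lemma dotpNr u v : dotp u (- v) = - dotp u v.
Proof. by rewrite -scaleN1r dotpZr mulN1r. Qed.

Lemma dotpBr u v w : dotp u (v - w) = dotp u v - dotp u w.
Proof. by rewrite dotpDr dotpNr. Qed.

Lemma dotp0r u : dotp u 0 = 0.
Proof. by rewrite -(scale0r 0) dotpZr mul0r. Qed.

Lemma dotpDl u v w : dotp (u + v) w = dotp u w + dotp v w.
Proof. by rewrite dotpC dotpDr !(dotpC w). Qed.

Lemma dotpZl a u v : dotp (a *: u) v = a * dotp u v.
Proof. by rewrite dotpC dotpZr dotpC. Qed.

Lemma dotpNl u v : dotp (- u) v = - dotp u v.
Proof. by rewrite dotpC dotpNr dotpC. Qed.

Lemma dotpBl u v w : dotp (u - v) w = dotp u w - dotp v w.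
Proof. by rewrite dotpDl dotpNl. Qed.

Lemma dotp0l u : dotp 0 u = 0.
Proof. by rewrite dotpC dotp0r. Qed.

Lemma dotp_sumr (I : finType) u (F : I -> 'cV[R]_n) :
  dotp u (\sum_i F i) = \sum_i dotp u (F i).
Proof. by rewrite /dotp mulmx_sumr summxE. Qed.

Lemma dotp_suml (I : finType) u (F : I -> 'cV[R]_n) :
  dotp (\sum_i F i) u = \sum_i dotp (F i) u.
Proof. by rewrite dotpC dotp_sumr; apply: eq_bigr => i _; rewrite dotpC. Qed.

Lemma dotp_delta u i : dotp u (delta_mx i 0) = u i 0.
Proof.
rewrite dotpE (bigD1 i)//= mxE !eqxx mulr1 big1 ?addr0// => j ji.
by rewrite mxE (negbTE ji) mulr0.
Qed.

Lemma dotp_ge0 u : 0 <= dotp u u.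
Proof. by rewrite dotpE sumr_ge0// => i _; rewrite -expr2 sqr_ge0. Qed.

Lemma dotp_eq0 u : dotp u u = 0 -> u = 0.
Proof.
rewrite dotpE => /eqP; rewrite psumr_eq0; last first.
  by move=> i _; rewrite -expr2 sqr_ge0.
move=> /allP u0; apply/colP => i; rewrite mxE.
have := u0 i (mem_index_enum i); rewrite /= mulf_eq0 orbb.
by move/eqP.
Qed.

Lemma enorm_sqr u : enorm u ^+ 2 = dotp u u.
Proof. by rewrite sqr_sqrtr// dotp_ge0. Qed.

Lemma dotpDD u v : dotp (u + v) (u + v) = dotp u u + 2 * dotp u v + dotp v v.
Proof. by rewrite dotpDr !dotpDl (dotpC v u); ring. Qed.

Lemma dotpBB u v : dotp (u - v) (u - v) = dotp u u - 2 * dotp u v + dotp v v.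
Proof. by rewrite dotpBr !dotpBl (dotpC v u); ring. Qed.

(** Young's inequality, that is [0 <= |e u - v|^2]. *)
Lemma dotp_young e u v : 0 < e ->
  2 * dotp u v <= e * dotp u u + e^-1 * dotp v v.
Proof.
move=> e0; have := dotp_ge0 (e *: u - v).
rewrite dotpBB !dotpZl dotpZr => h.
have -> : e * dotp u u + e^-1 * dotp v v =
    2 * dotp u v + e^-1 * (e * (e * dotp u u) - 2 * (e * dotp u v) + dotp v v).
  by field; rewrite gt_eqF.
by rewrite lerDl mulr_ge0// invr_ge0 ltW.
Qed.

Lemma enorm_le_sqr u v a : enorm u <= a * enorm v ->
  dotp u u <= a ^+ 2 * dotp v v.
Proof.
move=> h; rewrite -!enorm_sqr -exprMn lerXn2r// nnegrE ?sqrtr_ge0//.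
exact: le_trans (sqrtr_ge0 _) h.
Qed.

End InnerProduct.

Lemma dotp_mulmx (R : realType) m n (A : 'M[R]_(m, n)) u v :
  dotp (A *m u) v = dotp u (A^T *m v).
Proof. by rewrite /dotp trmx_mul mulmxA. Qed.

(** * Derivatives along lines *)

Section Lines.
Variables (R : realType) (n : nat).
Implicit Types (f : 'cV[R]_n -> R) (x d : 'cV[R]_n).

(** Reduces directional derivatives to the calculus of one real variable. *)
Lemma is_derive_line f x d t l : is_derive (x + t *: d) d (f : _ -> R^o) l <->
  is_derive t (1 : R) ((fun s => f (x + s *: d)) : R -> R^o) l.
Proof.
have E : (fun h : R => h^-1 *:
      (((f : _ -> R^o) \o shift (x + t *: d)) (h *: d) - f (x + t *: d))) =
   (fun h : R => h^-1 *:
      ((((fun s => f (x + s *: d)) : R -> R^o) \o shift t) (h *: 1) -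
        f (x + t *: d))).
  apply/funext => h /=; congr (_ *: (f _ - _)).
  by rewrite [h *: 1]mulr1 scalerDl addrCA.
by split=> -[h1 h2]; split; move: h1 h2; rewrite /derivable /derive E.
Qed.

Lemma derive_grad f x d : differentiable (f : _ -> R^o) x ->
  'D_d (f : _ -> R^o) x = dotp (grad f x) d.
Proof.
move=> df; rewrite deriveE//.
have -> : d = \sum_i d i 0 *: delta_mx i 0.
  rewrite [LHS]matrix_sum_delta; apply: eq_bigr => i _.
  by rewrite big_ord1.
rewrite linear_sum dotp_sumr; apply: eq_bigr => i _.
by rewrite linearZ dotpZr dotp_delta mxE deriveE.
Qed.

Lemma is_derive_grad_line f x d t :
    (forall y, differentiable (f : _ -> R^o) y) ->
  is_derive t (1 : R) ((fun s => f (x + s *: d)) : R -> R^o)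
    (dotp (grad f (x + t *: d)) d).
Proof.
move=> df; apply/is_derive_line; split; last exact: derive_grad.
exact: diff_derivable.
Qed.

Lemma is_derive_grad f x l :
    (forall d, is_derive (0 : R) (1 : R)
       ((fun s => f (x + s *: d)) : R -> R^o) (dotp l d)) ->
  grad f x = l.
Proof.
move=> h; apply/colP => i; rewrite mxE.
have /is_derive_line := h (delta_mx i 0).
by rewrite scale0r addr0 => -[_ ->]; rewrite dotp_delta.
Qed.

Lemma is_derive_sqnorm m (C : 'M[R]_(m, n)) (b : 'cV[R]_m) x d :
  is_derive (0 : R) (1 : R)
    ((fun s => dotp (C *m (x + s *: d) - b) (C *m (x + s *: d) - b)) : R -> R^o)
    (2 * dotp (C *m x - b) (C *m d)).
Proof.
have scaleE (a c : R) : a *: (c : R^o) = a * c by [].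
set p := C *m x - b; set q := C *m d.
have -> : (fun s => dotp (C *m (x + s *: d) - b) (C *m (x + s *: d) - b)) =
    cst (dotp p p) + (2 * dotp p q) \*: (@id R : R -> R^o) +
      (dotp q q) \*: ((@id R : R -> R^o) ^+ 2).
  apply/funext => s; rewrite !fctE.
  have -> : C *m (x + s *: d) - b = p + s *: q.
    by rewrite mulmxDr -scalemxAr addrAC.
  rewrite dotpDD dotpZl !dotpZr /= !scaleE; ring.
apply: is_derive_eq.
rewrite /= !scaleE; ring.
Qed.

Lemma derive_right_ge (g : R -> R) a l :
    is_derive (0 : R) (1 : R) (g : R -> R^o) l ->
    (forall t, 0 < t -> t < 1 -> t * a <= g t - g 0) ->
  a <= l.
Proof.
move=> [dg <-] h.
have cv : h^-1 *: ((g \o shift 0) (h *: (1 : R)) - g 0) @[h --> 0^'+] -->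
    'D_(1 : R) (g : R -> R^o) 0.
  apply: cvg_trans dg; apply: cvg_app.
  by move=> A [e e0 Ae]; exists e => // x xe x0; apply: Ae => //; rewrite gt_eqF.
rewrite -(cvg_lim _ cv)//; apply: limr_ge.
  by apply/cvg_ex; eexists; exact: cv.
near=> t.
have t0 : 0 < t by near: t; exact: nbhs_right_gt.
have t1 : t < 1 by near: t; exact: nbhs_right_lt.
rewrite /= addr0 [t *: 1]mulr1 -ler_pdivrMl ?invr_gt0// invrK.
exact: h.
Unshelve. all: by end_near. Qed.

End Lines.

(** * Convex functions with Lipschitz gradient *)

Section SmoothConvex.
Variables (R : realType) (n : nat) (f : 'cV[R]_n -> R).
Hypothesis f_convex : convex_function setT f.
Hypothesis f_diff : forall x, differentiable (f : _ -> R^o) x.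
Implicit Types x y : 'cV[R]_n.

Lemma convex_above_tangent x y : f x + dotp (grad f x) (y - x) <= f y.
Proof.
have dN := is_deriveN (is_derive_grad_line x (y - x) 0 f_diff).
rewrite scale0r addr0 in dN.
rewrite -lerBrDl -lerN2.
apply: (derive_right_ge dN) => t t0 t1.
rewrite !opprfctE /= scale0r addr0 opprK.
have cv : f (t *: y + (1 - t) *: x) <= t * f y + (1 - t) * f x.
  exact: (f_convex (Itv01 (ltW t0) (ltW t1)) (in_setT y) (in_setT x)).
have E : t *: y + (1 - t) *: x = x + t *: (y - x).
  by rewrite scalerBl scale1r scalerBr addrCA.
by rewrite E in cv; lra.
Qed.

Variable delta : R.
Hypothesis delta_gt0 : 0 < delta.
Hypothesis f_smooth : forall u v,
  enorm (grad f u - grad f v) <= delta * enorm (u - v).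

(** Along the segment the derivative exceeds its initial value by at most
    [delta * s * |d|^2], so subtracting the primitive of that excess leaves a
    function that lies below its tangent. *)
Lemma descent_lemma x d :
  f (x + d) <= f x + dotp (grad f x) d + delta / 2 * dotp d d.
Proof.
have scaleE (a c : R) : a *: (c : R^o) = a * c by [].
pose F := ((fun s => f (x + s *: d)) : R -> R^o) -
  (delta / 2 * dotp d d) \*: ((@id R : R -> R^o) ^+ 2).
pose F' s := dotp (grad f (x + s *: d)) d - delta * dotp d d * s.
have dF s : is_derive s (1 : R) F (F' s).
  have df := is_derive_grad_line x d s f_diff.
  apply: is_derive_eq; by rewrite /F' /= !scaleE; lra.
have cF : {within `[0, 1], continuous F}.
  by apply: derivable_within_continuous => u _; case: (dF u).
have [c c01] := MVT ltr01 (fun s _ => dF s) cF.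
have c0 : 0 < c by move: c01; rewrite in_itv/= => /andP[].
rewrite /F !fctE /= /F' !scaleE !scale1r scale0r addr0 => E.
suff : dotp (grad f (x + c *: d) - grad f x) d <= delta * c * dotp d d.
  rewrite dotpBl; lra.
have dc0 : 0 < (delta * c)^-1 by rewrite invr_gt0 mulr_gt0.
have Y := dotp_young (grad f (x + c *: d) - grad f x) d dc0.
have L := enorm_le_sqr (f_smooth (x + c *: d) x).
have L2 : (delta * c)^-1 *
    dotp (grad f (x + c *: d) - grad f x) (grad f (x + c *: d) - grad f x) <=
    delta * c * dotp d d.
  rewrite ler_pdivrMl ?mulr_gt0//; apply: le_trans L _.
  rewrite addrAC subrr add0r dotpZl dotpZr.
  have -> : delta ^+ 2 * (c * (c * dotp d d)) =
     delta * c * (delta * c * dotp d d) by ring.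
  exact: lexx.
rewrite invrK in Y; lra.
Qed.

Let bregman x y :
  f x + dotp (grad f x) (y - x) +
    (2 * delta)^-1 * dotp (grad f y - grad f x) (grad f y - grad f x) <= f y.
Proof.
set g := grad f y - grad f x.
have D := descent_lemma y (- delta^-1 *: g).
have T := convex_above_tangent x (y + - delta^-1 *: g).
rewrite !dotpZr dotpZl in D.
rewrite (addrAC y) dotpDr dotpZr in T.
have E : dotp (grad f y) g - dotp (grad f x) g = dotp g g by rewrite -dotpBl.
have E1 : dotp (grad f y) g = dotp (grad f x) g + dotp g g by rewrite -E; ring.
rewrite E1 in D.
have E2 : delta / 2 * (- delta^-1 * (- delta^-1 * dotp g g)) =
  (2 * delta)^-1 * dotp g g by field; rewrite gt_eqF.
rewrite E2 in D.
have E3 : delta^-1 * dotp g g = 2 * ((2 * delta)^-1 * dotp g g).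
  by field; rewrite gt_eqF.
move: ((2 * delta)^-1 * dotp g g) D E3 => k D E3; lra.
Qed.

(** Minimising the descent bound on [f] minus its tangent at the other point
    improves the tangent inequality by [|grad f y - grad f x|^2 / (2 delta)];
    exchanging the roles of the two points and adding gives cocoercivity. *)
Lemma grad_cocoercive x y :
  dotp (grad f x - grad f y) (grad f x - grad f y) <=
    delta * dotp (grad f x - grad f y) (x - y).
Proof.
have h1 := bregman x y; have h2 := bregman y x.
set g := grad f x - grad f y in h2 *.
have Eg : grad f y - grad f x = - g by rewrite opprB.
have Ed : y - x = - (x - y) by rewrite opprB.
rewrite Eg dotpNl dotpNr opprK Ed dotpNr in h1.
have E : dotp g g = delta * (2 * ((2 * delta)^-1 * dotp g g)).
  by field; rewrite gt_eqF.
have E' : dotp g (x - y) = dotp (grad f x) (x - y) - dotp (grad f y) (x - y).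
  exact: dotpBl.
rewrite E ler_pM2l// E'; lra.
Qed.

End SmoothConvex.

(** * Subgradients of extended-valued convex functions *)

Definition is_subgradient (R : realType) (n : nat) (f : 'cV[R]_n -> \bar R)
    (p g : 'cV[R]_n) : Prop :=
  f p \is a fin_num /\ forall z, (f p + (dotp g (z - p))%:E <= f z)%E.

Section Subgradient.
Variables (R : realType) (n : nat) (f : 'cV[R]_n -> \bar R).

Lemma subgradient_monotone p q g h :
  is_subgradient f p g -> is_subgradient f q h -> 0 <= dotp (g - h) (p - q).
Proof.
move=> [fp /(_ q)] + [fq /(_ p)].
rewrite -(fineK fp) -(fineK fq) -!EFinD !lee_fin.
rewrite -(opprB p q) dotpNr dotpBl; lra.
Qed.

Hypothesis f_proper : proper_ext f.
Hypothesis f_convex : convex_ext f.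

(** Fermat's rule for a nonsmooth plus a differentiable term. Comparing the
    minimiser with the points [x + t (z - x)], convexity of [f] gives
    [t (f x - f z) <= h (x + t (z - x)) - h x]; then [t] tends to [0]. *)
Lemma argmin_subgradient h x g :
    argmin (fun v => (f v + (h v)%:E)%E) x ->
    (forall d, is_derive (0 : R) (1 : R)
      ((fun s => h (x + s *: d)) : R -> R^o) (dotp g d)) ->
  is_subgradient f x (- g).
Proof.
move=> xmin dh; have [fNoo [x0 fx0]] := f_proper.
have fx : f x \is a fin_num.
  rewrite fin_numE fNoo/=; apply: contra_neq fx0 => fxoo.
  have := xmin x0; rewrite fxoo addye// leye_eq.
  have := fNoo x0; by case: (f x0).
split=> // z.
have [->|fzoo] := eqVneq (f z) +oo%E; first by rewrite leey.
have fz : f z \is a fin_num by rewrite fin_numE fNoo.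
rewrite -(fineK fx) -(fineK fz) -EFinD lee_fin dotpNl lerBlDl -lerBlDr.
apply: (derive_right_ge (dh (z - x))) => t t0 t1.
have := f_convex z x (ltW t0) (ltW t1).
have -> : t *: z + (1 - t) *: x = x + t *: (z - x).
  by rewrite scalerBl scale1r scalerBr addrCA.
move=> cv; have := xmin (x + t *: (z - x)).
rewrite scale0r addr0.
have fv : f (x + t *: (z - x)) \is a fin_num.
  rewrite fin_numE fNoo -ltey/=; apply: le_lt_trans cv _.
  by rewrite -(fineK fx) -(fineK fz) -!EFinM -EFinD ltry.
move: cv; rewrite -(fineK fx) -(fineK fz) -(fineK fv) -!EFinM -!EFinD !lee_fin.
by move=> c1 c2; lra.
Qed.

(** Fermat's rule for the proximal objective, whose quadratic term has gradient
    [mu^-1 (p - x)] at [p]. *)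
Lemma prox_subgradient mu x p : 0 < mu ->
  prox mu f x p -> is_subgradient f p (mu^-1 *: (x - p)).
Proof.
move=> mu0 pmin.
have -> : mu^-1 *: (x - p) = - (mu^-1 *: (p - x)) by rewrite -scalerN opprB.
apply: argmin_subgradient pmin _ => d.
have := is_deriveZ (2 * mu)^-1 (is_derive_sqnorm 1%:M x p d).
rewrite !mul1mx => dq.
have -> : (fun s => (2 * mu)^-1 * enorm (p + s *: d - x) ^+ 2) =
    (2 * mu)^-1 \*: ((fun s => dotp (1%:M *m (p + s *: d) - x)
                        (1%:M *m (p + s *: d) - x)) : R -> R^o).
  by apply/funext => s; rewrite enorm_sqr /= mul1mx.
apply: is_derive_eq; rewrite dotpZl [LHS]mulrA; congr (_ * _).
by field; rewrite gt_eqF.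
Qed.

End Subgradient.

(** Proximal steps are nonexpansive because subgradients are monotone: if
    [p = prox x] and [q = prox y] then [0 <= <(x - p) - (y - q), p - q>]. *)
Lemma subgradient_nonexpansive (R : realType) (n : nat)
    (f : 'cV[R]_n -> \bar R) mu (x y p q : 'cV[R]_n) : 0 < mu ->
    is_subgradient f p (mu^-1 *: (x - p)) ->
    is_subgradient f q (mu^-1 *: (y - q)) ->
  dotp (p - q) (p - q) <= dotp (x - y) (x - y).
Proof.
move=> mu0 fp fq; have := subgradient_monotone fp fq.
rewrite -scalerBr dotpZl pmulr_rge0 ?invr_gt0//.
have -> : x - p - (y - q) = (x - y) - (p - q) 
  by apply/colP => i; rewrite !mxE; ring.
rewrite dotpBl => h.
have := dotp_young (x - y) (p - q) ltr01; rewrite invr1 !mul1r; lra.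
Qed.

(** * Rayleigh quotients of symmetric matrices *)

Section Rayleigh.
Variables (R : realType) (n : nat).
Implicit Types (N : 'M[R]_n) (V : set 'cV[R]_n).

(** A vector where a nonnegative quadratic form vanishes minimises the form, so
    the form has zero gradient there; testing in the single direction [N x], which
    stays in [V], is enough. *)
Lemma psd_isotropic N V x :
    N^T = N ->
    (forall u v, V u -> V v -> V (u + v)) ->
    (forall a u, V u -> V (a *: u)) ->
    (forall u, V u -> V (N *m u)) ->
    (forall u, V u -> 0 <= dotp u (N *m u)) ->
    V x -> dotp x (N *m x) = 0 ->
  N *m x = 0.
Proof.
move=> Nsym VD VZ VN Npos Vx x0; apply: dotp_eq0.
set y := N *m x; set b := dotp y (N *m y).
have b0 : 0 <= b by apply/Npos/VN.
(* at [x + s N x] the form equals [2 s |N x|^2 + s^2 b] *)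
have key s : 0 <= s * (2 * dotp y y + s * b).
  have := Npos _ (VD _ _ Vx (VZ s _ (VN _ Vx))).
  rewrite mulmxDr -scalemxAr -/y dotpDr !dotpDl !dotpZr !dotpZl x0 -/b.
  have -> : dotp x (N *m y) = dotp y y by rewrite -{1}Nsym -dotp_mulmx.
  by congr (0 <= _); ring.
apply/eqP; rewrite eq_le dotp_ge0 andbT leNgt; apply/negP => q0.
have c0 : 0 < b + 1 by rewrite ltr_pwDr.
have := key (- (dotp y y / (b + 1))).
rewrite mulNr oppr_ge0 pmulr_rle0 ?divr_gt0//.
have -> : 2 * dotp y y + - (dotp y y / (b + 1)) * b =
    dotp y y + dotp y y / (b + 1) by field; rewrite gt_eqF.
by rewrite leNgt addr_gt0// divr_gt0.
Qed.

Lemma continuous_dotp_mulmx N :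
  continuous (fun v : 'rV[R]_n => dotp v^T (N *m v^T)).
Proof.
have -> : (fun v : 'rV[R]_n => dotp v^T (N *m v^T)) =
    (fun v => \sum_i \sum_j (v 0 i * (N i j * v 0 j))).
  apply/funext => v; rewrite dotpE; apply: eq_bigr => i _.
  rewrite !mxE mulr_sumr; apply: eq_bigr => j _.
  by rewrite !mxE.
have addc : continuous (fun p : R * R => p.1 + p.2) by exact: add_continuous.
apply: continuous_big => // i _; apply: continuous_big => // j _ v.
have cc k : {for v, continuous (fun w : 'rV[R]_n => w 0 k)}.
  exact: coord_continuous.
have c2 : {for v, continuous (fun w : 'rV[R]_n => N i j * w 0 j)}.
  apply: (@continuousM _ _ (cst (N i j)) (fun w : 'rV[R]_n => w 0 j)) => //.
  exact: cst_continuous.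
exact: (@continuousM _ _ (fun w : 'rV[R]_n => w 0 i)
                         (fun w : 'rV[R]_n => N i j * w 0 j)).
Qed.

(** The Rayleigh quotient of a symmetric matrix attains its minimum on the unit
    sphere of a closed invariant subspace, and a minimiser is an eigenvector:
    the shifted form is nonnegative on the subspace and vanishes there. *)
Lemma rayleigh_min N V :
    N^T = N ->
    (forall u v, V u -> V v -> V (u + v)) ->
    (forall a u, V u -> V (a *: u)) ->
    (forall u, V u -> V (N *m u)) ->
    closed [set v : 'rV[R]_n | V v^T] ->
    (exists2 x, V x & x != 0) ->
  exists l x, [/\ V x, x != 0, N *m x = l *: x &
    forall u, V u -> l * dotp u u <= dotp u (N *m u)].
Proof.
move=> Nsym VD VZ VN Vcl [x0 Vx0 x00].
have norm_gt0 u : u != 0 -> 0 < dotp u u.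
  move=> u0; rewrite lt_neqAle dotp_ge0 andbT eq_sym.
  by apply: contra_neq u0; exact: dotp_eq0.
have unit u : V u -> u != 0 ->
    exists2 a, a != 0 & V (a *: u) /\ dotp (a *: u) (a *: u) = 1.
  move=> Vu /norm_gt0 u0; exists (Num.sqrt (dotp u u))^-1.
    by rewrite invr_eq0 gt_eqF// sqrtr_gt0.
  split; first exact: VZ.
  rewrite dotpZl dotpZr mulrA -invfM -expr2 sqr_sqrtr ?dotp_ge0// mulVf//.
  by rewrite gt_eqF.
pose S := [set v : 'rV[R]_n | V v^T] `&`
          (fun v : 'rV[R]_n => dotp v^T v^T) @^-1` [set 1].
have S0 : S !=set0.
  have [a _ [Va a1]] := unit _ Vx0 x00.
  by exists (a *: x0)^T; split; rewrite /= trmxK.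
have cdot : continuous (fun v : 'rV[R]_n => dotp v^T v^T).
  have -> : (fun v : 'rV[R]_n => dotp v^T v^T) =
      (fun v => dotp v^T (1%:M *m v^T)) by apply/funext => v; rewrite mul1mx.
  exact: continuous_dotp_mulmx.
have Scompact : compact S.
  apply: bounded_closed_compact.
    exists 1; split=> // M M1 v [_ /= v1].
    rewrite [leLHS]/Num.Def.normr/= mx_normrE.
    apply: bigmax_le => [|[i j] _ /=]; first exact: le_trans ler01 (ltW M1).
    apply: le_trans _ (ltW M1).
    rewrite -(@ler_pXn2r _ 2) ?nnegrE// expr1n real_normK ?num_real//.
    rewrite -v1 dotpE (bigD1 j)//= !mxE -expr2 [i]ord1 lerDl sumr_ge0// => k _.
    by rewrite -expr2 sqr_ge0.
  apply: closedI => //; move/continuous_closedP: cdot => cdot.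
  by apply: cdot; exact: closed_eq.
have [c cS cmin] := EVT_min_rV S0 Scompact
  (continuous_subspaceT (@continuous_dotp_mulmx N)).
move: cS; rewrite inE => -[Vc c1].
pose x := c^T; pose l := dotp x (N *m x).
have lmin u : V u -> l * dotp u u <= dotp u (N *m u).
  have [->|u0] := eqVneq u 0; first by rewrite !dotp0l mulr0.
  move=> Vu; have [a a0 [Va a1]] := unit _ Vu u0.
  have aS : S (a *: u)^T by split; rewrite /= trmxK.
  have := cmin _ (mem_set aS); rewrite trmxK -/x -/l.
  move: a1; rewrite -scalemxAr !dotpZl !dotpZr => a1 h.
  rewrite -(@ler_pM2l _ (a ^+ 2)) ?exprn_even_gt0//.
  have -> : a ^+ 2 * (l * dotp u u) = l * (a * (a * dotp u u)) by ring.
  by rewrite a1 mulr1 expr2 -mulrA.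
exists l, x; split=> //.
  apply/eqP => xz; move: c1; rewrite /= -/x xz dotp0l => /esym/eqP.
  by rewrite oner_eq0.
have E u : (N - l%:M) *m u = N *m u - l *: u by rewrite mulmxBl mul_scalar_mx.
apply/subr0_eq; rewrite -E.
apply: (@psd_isotropic _ V) => //.
- by rewrite linearB/= Nsym tr_scalar_mx.
- by move=> u Vu; rewrite E -scaleNr; apply: VD; [exact: VN|exact: VZ].
- by move=> u Vu; rewrite E dotpBr dotpZr subr_ge0 lmin.
- by rewrite E dotpBr dotpZr c1 mulr1 subrr.
Qed.

End Rayleigh.

(** * Spectral bounds for a positive semidefinite square root *)

(** The columns of [cokermx B] are annihilated by [B], and orthogonality to them
    is the criterion for [x^T] to lie in the row space of [B], that is, for [x] to
    lie in the range of [B^T = B]. *)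
Lemma symmetric_range (R : realType) n (B : 'M[R]_n) (x : 'cV[R]_n) :
    B^T = B -> (forall k : 'cV[R]_n, B *m k = 0 -> dotp x k = 0) ->
  exists d, x = B *m d.
Proof.
move=> Bsym xker; suff /submxP[d xd] : (x^T <= B)%MS.
  by exists d^T; rewrite -[LHS]trmxK xd trmx_mul Bsym.
rewrite submxE; apply/eqP/rowP => j.
have := xker (cokermx B *m delta_mx j 0).
rewrite mulmxA mulmx_coker mul0mx => /(_ erefl).
by rewrite /dotp mulmxA -colE !mxE.
Qed.

Section SquareRoot.
Variables (R : realType) (n : nat) (B S : 'M[R]_n).
Hypothesis SB : psd_sqrt B S.
Implicit Types x : 'cV[R]_n.

Lemma sqrt_sym : S^T = S.
Proof. by case: SB => -[]. Qed.

Lemma sqrt_mul : S *m S = B.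
Proof. by case: SB. Qed.

Lemma sqrt_dotp x y : dotp (S *m x) y = dotp x (S *m y).
Proof. by rewrite dotp_mulmx sqrt_sym. Qed.

Lemma sqr_sym : B^T = B.
Proof. by rewrite -sqrt_mul trmx_mul sqrt_sym. Qed.

Lemma sqr_form x : dotp x (B *m x) = dotp (S *m x) (S *m x).
Proof. by rewrite sqrt_dotp mulmxA sqrt_mul. Qed.

Lemma ker_sqrt x : B *m x = 0 -> S *m x = 0.
Proof. by move=> Bx; apply: dotp_eq0; rewrite -sqr_form Bx dotp0r. Qed.

(** [S] and [B] have the same kernel, hence the same range. *)
Lemma range_sqrt x : exists d, S *m x = B *m d.
Proof.
apply: symmetric_range sqr_sym _ => k /ker_sqrt Sk.
by rewrite sqrt_dotp Sk dotp0r.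
Qed.

Lemma eigen_singular_value l x :
  0 <= l -> x != 0 -> B *m x = l *: x -> singular_values B l.
Proof.
move=> l0 x0 Bx; split=> //; apply/eigenvalueP; exists x^T; last first.
  by apply: contra_neq x0 => /(congr1 trmx); rewrite trmxK trmx0.
rewrite sqr_sym.
have Bx' : x^T *m B = l *: x^T by rewrite -[B in LHS]sqr_sym -trmx_mul Bx linearZ.
by rewrite mulmxA Bx' -scalemxAl Bx' scalerA expr2.
Qed.

(** Minimising the quotient of [- B] over the whole space exhibits the largest
    value of [|S x|^2 / |x|^2] as an eigenvalue of [B]. *)
Lemma sqrt_upper smax x : largest_singular_value B smax ->
  dotp (S *m x) (S *m x) <= smax * dotp x x.
Proof.
move=> [_ smaxP].
have [->|x0] := eqVneq x 0; first by rewrite mulmx0 !dotp0r mulr0.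
have NBsym : (- B)^T = - B by rewrite linearN/= sqr_sym.
have VT : [set v : 'rV[R]_n | [set: 'cV[R]_n] v^T] = setT by apply/seteqP.
have VTcl : closed [set v : 'rV[R]_n | [set: 'cV[R]_n] v^T].
  by rewrite VT; exact: closedT.
have [//|//|//||l [u [_ u0 Bu lmin]]] := rayleigh_min NBsym _ _ _ VTcl.
  by exists x.
have {}Bu : B *m u = (- l) *: u by rewrite scaleNr -Bu mulNmx opprK.
have l0 : 0 <= - l.
  have : 0 <= dotp u (B *m u) by rewrite sqr_form dotp_ge0.
  rewrite Bu dotpZr pmulr_lge0// lt_neqAle dotp_ge0 andbT eq_sym.
  by apply: contra_neq u0; exact: dotp_eq0.
have := lmin x I; rewrite mulNmx dotpNr sqr_form lerNr -mulNr => /le_trans; apply.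
by rewrite ler_wpM2r ?dotp_ge0//; apply/smaxP/(eigen_singular_value l0 u0).
Qed.

(** On the range of [B] the form has no isotropic vector, so its minimal
    Rayleigh quotient there is a nonzero singular value. *)
Lemma sqrt_lower smin x : smallest_nonzero_singular_value B smin ->
  smin * dotp (S *m x) (S *m x) <= dotp (S *m (S *m x)) (S *m (S *m x)).
Proof.
move=> [_ _ sminP]; have [d ->] := range_sqrt x; set z := B *m d.
have [->|z0] := eqVneq z 0; first by rewrite mulmx0 !dotp0r mulr0.
pose V := [set u | exists e : 'cV[R]_n, u = B *m e].
have ker_range u : B *m u = 0 -> V u -> u = 0.
  move=> Bu [e ue]; apply: dotp_eq0.
  by rewrite {1}ue dotp_mulmx sqr_sym Bu dotp0r.
pose C := (cokermx B)^T.
have CB : C *m B = 0.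
  by apply: trmx_inj; rewrite trmx_mul trmxK sqr_sym mulmx_coker trmx0.
have VE : [set v : 'rV[R]_n | V v^T] =
    (fun v : 'rV[R]_n => dotp v^T ((C^T *m C) *m v^T)) @^-1` [set 0].
  apply/seteqP; split=> v /=.
    move=> [e ve]; rewrite -mulmxA -dotp_mulmx ve.
    by rewrite mulmxA CB mul0mx dotp0r.
  rewrite -mulmxA -dotp_mulmx => /dotp_eq0.
  rewrite /C -trmx_mul => /(congr1 trmx); rewrite trmxK trmx0 => vC.
  have /submxP[e ->] : (v <= B)%MS by rewrite submxE vC.
  by exists e^T; rewrite trmx_mul sqr_sym.
have [|||||l [u [Vu u0 Bu lmin]]] := @rayleigh_min _ _ B V sqr_sym.
- by move=> _ _ [e ->] [f ->]; exists (e + f); rewrite mulmxDr.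
- by move=> a _ [e ->]; exists (a *: e); rewrite scalemxAr.
- by move=> _ [e ->]; exists (B *m e).
- rewrite VE; have := @continuous_dotp_mulmx _ _ (C^T *m C).
  by move=> /continuous_closedP; apply; exact: closed_eq.
- by exists z => //; exists d.
have uu : 0 < dotp u u.
  rewrite lt_neqAle dotp_ge0 andbT eq_sym.
  by apply: contra_neq u0; exact: dotp_eq0.
have l0 : 0 <= l.
  have : 0 <= dotp u (B *m u) by rewrite sqr_form dotp_ge0.
  by rewrite Bu dotpZr pmulr_lge0.
have ln0 : l != 0.
  apply: contra_neq u0 => l00; apply: ker_range => //.
  by rewrite Bu l00 scale0r.
have Vz : V z by exists d.
rewrite -[leRHS]sqr_form; apply: le_trans (lmin z Vz).
rewrite ler_wpM2r ?dotp_ge0//; apply: sminP => //.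
exact: eigen_singular_value Bu.
Qed.

End SquareRoot.

(** * Block structure of the stacked space *)

Definition stack (R : realType) (K M : nat) (f : 'I_K -> 'cV[R]_M) :
    'cV[R]_(K * M) :=
  \col_i f (mxtens_unindex i).1 (mxtens_unindex i).2 0.

Definition consensus (R : realType) (K M : nat) (a : 'cV[R]_M) :
    'cV[R]_(K * M) :=
  tensmx (const_mx 1 : 'cV[R]_K) a.

Section Blocks.
Variables (R : realType) (K M : nat).
Implicit Types (u v w x : 'cV[R]_(K * M)) (k : 'I_K) (a : 'cV[R]_M).

Lemma block_stack k (f : 'I_K -> 'cV[R]_M) : block k (stack f) = f k.
Proof. by apply/colP => j; rewrite !mxE mxtens_indexK. Qed.

Lemma eq_blocks u v : (forall k, block k u = block k v) -> u = v.
Proof.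
move=> uv; apply/colP => i; case: (mxtens_indexP i) => k j.
by have /colP/(_ j) := uv k; rewrite !mxE.
Qed.

Lemma blockD k u v : block k (u + v) = block k u + block k v.
Proof. by apply/colP => j; rewrite !mxE. Qed.

Lemma blockN k u : block k (- u) = - block k u.
Proof. by apply/colP => j; rewrite !mxE. Qed.

Lemma blockB k u v : block k (u - v) = block k u - block k v.
Proof. by rewrite blockD blockN. Qed.

Lemma blockZ k (t : R) u : block k (t *: u) = t *: block k u.
Proof. by apply/colP => j; rewrite !mxE. Qed.

Lemma block_consensus k a : block k (consensus K a) = a.
Proof.
apply/colP => j; rewrite !mxE mxtens_indexK/= mul1r.
by congr (a _ _); exact: ord1.
Qed.

Lemma dotp_blocks u v : dotp u v = \sum_k dotp (block k u) (block k v).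
Proof.
rewrite dotpE (reindex (@mxtens_index K M))/=; last first.
  exists (@mxtens_unindex K M) => i _; first by rewrite mxtens_indexK.
  by rewrite mxtens_unindexK.
under [RHS]eq_bigr do rewrite dotpE.
rewrite pair_bigA/=; apply: eq_bigr => -[k j] _.
by rewrite !mxE.
Qed.

Lemma dotp_consensusr u a : dotp u (consensus K a) = dotp (\sum_k block k u) a.
Proof.
rewrite dotp_blocks dotp_suml; apply: eq_bigr => k _.
by rewrite block_consensus.
Qed.

Lemma block_tensmx k (A : 'M[R]_K) x :
  block k (tensmx A (1%:M : 'M[R]_M) *m x) = \sum_l A k l *: block l x.
Proof.
apply/colP => j; rewrite !mxE summxE (reindex (@mxtens_index K M))/=; last first.
  exists (@mxtens_unindex K M) => i _; first by rewrite mxtens_indexK.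
  by rewrite mxtens_unindexK.
transitivity (\sum_l \sum_i tensmx A (1%:M : 'M[R]_M) (mxtens_index (k, j))
    (mxtens_index (l, i)) * x (mxtens_index (l, i)) 0).
  by rewrite pair_bigA/=; apply: eq_bigr => -[l i].
apply: eq_bigr => l _; rewrite !mxE (bigD1 j)//= tensmxE mxE eqxx mulr1 big1.
  by rewrite addr0.
by move=> i ij; rewrite tensmxE mxE eq_sym (negbTE ij) mulr0 mul0r.
Qed.

End Blocks.

(** * The kernel of [Bcal] *)

(** A fixed vector is also fixed by a positive stochastic power of [A]. At an
    index where it is largest it equals a weighted mean of all its entries with
    positive weights, so no entry is smaller. *)
Lemma primitive_fixed_constant (R : realType) K (A : 'M[R]_K) (x : 'cV[R]_K) :
    primitive A -> A *m const_mx 1 = const_mx 1 :> 'cV[R]_K -> A *m x = x ->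
  forall i j, x i 0 = x j 0.
Proof.
move=> [p Ap0] A1 Ax.
have pow (y : 'cV[R]_K) : A *m y = y -> (A ^+ p) *m y = y.
  move=> Ay; elim: p {Ap0} => [|q IHq]; first by rewrite expr0 mul1mx.
  by rewrite exprS -mulmxA IHq.
move: {Ax A1} (pow _ A1) (pow _ Ax); set Q := A ^+ p => Q1 Qx.
have all_max i0 : (forall j, x j 0 <= x i0 0) -> forall j, x j 0 = x i0 0.
  move=> imax.
  have S0 : \sum_j Q i0 j * (x i0 0 - x j 0) = 0.
    have q1 : \sum_j Q i0 j = 1.
      have /colP/(_ i0) := Q1; rewrite !mxE => <-.
      by apply: eq_bigr => j _; rewrite mxE mulr1.
    have /colP/(_ i0) := Qx; rewrite !mxE => qx.
    under eq_bigr do rewrite mulrBr.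
    by rewrite sumrB -mulr_suml q1 mul1r qx subrr.
  have P0 j : true -> 0 <= Q i0 j * (x i0 0 - x j 0).
    by move=> _; rewrite mulr_ge0 ?subr_ge0// ltW// Ap0.
  move=> j; have := psumr_eq0P P0 S0 (i := j) isT.
  move/eqP; rewrite mulf_eq0 gt_eqF ?Ap0//= subr_eq0 => /eqP ->.
  by [].
move=> i j; pose i0 := [arg max_(i' > i) x i' 0]%O.
have imax k : x k 0 <= x i0 0 by rewrite /i0; case: arg_maxP => // m _; apply.
by rewrite (all_max _ imax i) (all_max _ imax j).
Qed.

Section KernelB.
Variables (R : realType) (K M : nat) (A : 'M[R]_K).
Hypothesis K_gt0 : (0 < K)%N.
Hypothesis A_ds : doubly_stochastic A.
Hypothesis A_prim : primitive A.

Let A_rows (k : 'I_K) : \sum_l A k l = 1.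
Proof.
case: A_ds => _ /colP/(_ k) + _; rewrite !mxE => <-.
by apply: eq_bigr => l _; rewrite mxE mulr1.
Qed.

Lemma Bcal_consensus (a : 'cV[R]_M) : Bcal M A *m consensus K a = 0.
Proof.
rewrite -scalemxAl mulmxBl mul1mx -(scaler0 _ 2^-1); congr (_ *: _).
apply/eqP; rewrite subr_eq0 eq_sym; apply/eqP/eq_blocks => k.
rewrite block_tensmx block_consensus.
under eq_bigr do rewrite block_consensus.
by rewrite -scaler_suml A_rows scale1r.
Qed.

Lemma ker_Bcal (x : 'cV[R]_(K * M)) :
  Bcal M A *m x = 0 -> exists a, x = consensus K a.
Proof.
move=> /eqP; rewrite -scalemxAl scaler_eq0 invr_eq0 pnatr_eq0/=.
rewrite mulmxBl mul1mx subr_eq0 => /eqP xfix.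
exists (block (Ordinal K_gt0) x); apply: eq_blocks => k.
rewrite block_consensus; apply/colP => j.
pose y := \col_(l < K) block l x j 0.
have Ay : A *m y = y.
  apply/colP => l; rewrite !mxE.
  have /(congr1 (fun v => block l v j 0)) := xfix.
  rewrite block_tensmx summxE mxE => ->; apply: eq_bigr => m _.
  by rewrite !mxE.
case: A_ds => _ A1 _.
by have := primitive_fixed_constant A_prim A1 Ay k (Ordinal K_gt0); rewrite !mxE.
Qed.

End KernelB.

(** * Gradients of the aggregate costs *)

Section Gradients.
Variables (R : realType) (K M : nat) (J : 'I_K -> 'cV[R]_M -> R).
Hypothesis J_diff : forall k x, differentiable (J k : _ -> R^o) x.

Definition gradJ (w : 'cV[R]_(K * M)) : 'cV[R]_(K * M) :=
  stack (fun k => grad (J k) (block k w)).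

Lemma is_derive_Jbar_line x d :
  is_derive (0 : R) (1 : R) ((fun s => Jbar J (x + s *: d)) : R -> R^o)
    (dotp (K%:R^-1 *: \sum_k grad (J k) x) d).
Proof.
have -> : (fun s => Jbar J (x + s *: d)) = K%:R^-1 \*:
    (\sum_k ((fun s => J k (x + s *: d)) : R -> R^o)).
  by apply/funext => s /=; rewrite fct_sumE.
rewrite dotpZl dotp_suml; apply: is_deriveZ; apply: is_derive_sum => k.
by have := is_derive_grad_line x d 0 (J_diff k); rewrite scale0r addr0.
Qed.

Lemma grad_Jbar x : grad (Jbar J) x = K%:R^-1 *: \sum_k grad (J k) x.
Proof. by apply: is_derive_grad => d; exact: is_derive_Jbar_line. Qed.

Lemma grad_Jmu (B S : 'M[R]_(K * M)) mu w : psd_sqrt B S ->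
  grad (Jmu J S mu) w = gradJ w + mu^-1 *: (B *m w).
Proof.
move=> SB; apply: is_derive_grad => d.
have -> : (fun s => Jmu J S mu (w + s *: d)) =
    (\sum_k ((fun s => J k (block k w + s *: block k d)) : R -> R^o)) +
    (2 * mu)^-1 \*: ((fun s => dotp (S *m (w + s *: d) - 0)
                        (S *m (w + s *: d) - 0)) : R -> R^o).
  apply/funext => s; rewrite /Jmu enorm_sqr -[in LHS](subr0 (S *m _)).
  congr (_ + _).
  by rewrite fct_sumE; apply: eq_bigr => k _; rewrite blockD blockZ.
rewrite dotpDl; apply: is_deriveD.
  rewrite dotp_blocks; apply: is_derive_sum => k.
  have := is_derive_grad_line (block k w) (block k d) 0 (J_diff k).
  by rewrite scale0r addr0 /gradJ block_stack.
have := is_deriveZ (2 * mu)^-1 (is_derive_sqnorm S 0 w d).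
have -> // : (2 * mu)^-1 *: ((2 * dotp (S *m w - 0) (S *m d)) : R^o) =
    dotp (mu^-1 *: (B *m w)) d.
rewrite dotpZl subr0 -(sqrt_dotp SB) mulmxA (sqrt_mul SB).
rewrite [LHS]mulrA; congr (_ * _).
by rewrite invfM mulrAC mulVf ?mul1r// pnatr_eq0.
Qed.

End Gradients.

(** * The separable regulariser *)

Section Separable.
Variables (R : realType) (K M : nat) (r : 'cV[R]_M -> \bar R).
Hypothesis r_proper : proper_ext r.

Lemma Rcal_proper : proper_ext (@Rcal R K M r).
Proof.
have [rNy [x0 rx0]] := r_proper; split=> [w|].
  by apply/eqP => /esum_eqNyP[k [_ _ /eqP]]; apply/negP/rNy.
exists (stack (fun=> x0)).
have : Rcal r (stack (fun=> x0 : 'cV[R]_M) : 'cV[R]_(K * M)) \is a fin_num.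
  by apply/sum_fin_numP => k _ _; rewrite block_stack fin_numE rNy.
by rewrite fin_numE => /andP[].
Qed.

Lemma Rcal_convex : convex_ext r -> convex_ext (@Rcal R K M r).
Proof.
move=> rcvx x y t t0 t1; have [rNy _] := r_proper.
have ad (u v : 'cV[R]_M) : (r u +? r v)%E.
  by apply: ltninfty_adde_def; rewrite inE ltNye.
rewrite /Rcal !fin_num_sume_distrr//.
rewrite -big_split/=; apply: lee_sum => k _.
by rewrite blockD !blockZ; exact: rcvx.
Qed.

Lemma Rcal_subgradient (p g : 'cV[R]_(K * M)) :
  (forall k, is_subgradient r (block k p) (block k g)) ->
  is_subgradient (@Rcal R K M r) p g.
Proof.
move=> h; split=> [|z].
  by apply/sum_fin_numP => k _ _; case: (h k).
rewrite /Rcal dotp_blocks -sumEFin -big_split/=; apply: lee_sum => k _.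
by rewrite blockB; case: (h k).
Qed.

End Separable.

(** * Cocoercivity and restricted strong monotonicity *)

(** The cross term [2 <a, b>] is split by Young's inequality with the ratio
    [L2 / L1], for which both squares receive the same constant [L1 + L2]. *)
Lemma cocoerciveD (R : realType) n (L1 L2 : R) (a b x : 'cV[R]_n) :
    0 < L1 -> 0 < L2 ->
    dotp a a <= L1 * dotp a x -> dotp b b <= L2 * dotp b x ->
  dotp (a + b) (a + b) <= (L1 + L2) * dotp (a + b) x.
Proof.
move=> L1_gt0 L2_gt0 ax bx.
have e0 : 0 < L2 / L1 by rewrite divr_gt0.
have Y := dotp_young a b e0; rewrite invf_div in Y.
rewrite dotpDD dotpDl.
have h1 : L2 / L1 * dotp a a <= L2 * dotp a x.
  by rewrite -mulrA ler_pM2l// ler_pdivrMl.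
have h2 : L1 / L2 * dotp b b <= L1 * dotp b x.
  by rewrite -mulrA ler_pM2l// ler_pdivrMl.
lra.
Qed.

(** In the application [g1] is the variation of the gradient along [v] and [g0]
    its variation along [u]; only the cross terms [<g1, u>] and [<g0, v>] can be
    negative, and Young's inequality charges half of them to [nu |u|^2]. *)
Lemma two_scale_bound (R : realType) n (nu delta : R) (g0 g1 u v : 'cV[R]_n) :
    0 < nu -> 0 < delta ->
    0 <= dotp g1 v -> nu * dotp u u <= dotp g0 u ->
    dotp g1 g1 <= delta ^+ 2 * dotp v v -> dotp g0 g0 <= delta ^+ 2 * dotp u u ->
  nu / 2 * dotp u u - 2 * delta ^+ 2 / nu * dotp v v <= dotp (g1 + g0) (u + v).
Proof.
move=> nu_gt0 delta_gt0 m1 s1 l1 l0.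
have e1 : 0 < 2 / nu by rewrite divr_gt0.
have e2 : 0 < nu / (2 * delta ^+ 2) by rewrite divr_gt0// mulr_gt0// exprn_gt0.
have := dotp_young (- g1) u e1; have := dotp_young (- g0) v e2.
rewrite !dotpNl !dotpNr !opprK !invf_div => y0 y1.
have k1 : 2 / nu * dotp g1 g1 <= 2 * delta ^+ 2 / nu * dotp v v.
  have -> : 2 * delta ^+ 2 / nu * dotp v v = 2 / nu * (delta ^+ 2 * dotp v v).
    by ring.
  by rewrite ler_pM2l.
have k0 : nu / (2 * delta ^+ 2) * dotp g0 g0 <= nu / 2 * dotp u u.
  have -> : nu / 2 * dotp u u =
      nu / (2 * delta ^+ 2) * (delta ^+ 2 * dotp u u).
    by field; rewrite gt_eqF.
  by rewrite ler_pM2l.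
rewrite dotpDl !dotpDr.
move: (2 / nu * dotp g1 g1) (nu / (2 * delta ^+ 2) * dotp g0 g0)
  (2 * delta ^+ 2 / nu * dotp v v) k1 k0 y0 y1 => G1 G0 V k1 k0 y0 y1.
by clear l1 l0 e1 e2; lra.
Qed.

(** As [G] is nonnegative anyway, only a fraction [th] of its lower bound is
    kept, so small that [P] absorbs the loss in [V]. *)
Lemma absorb_deficit (R : realType) (c D s : R) : 0 < c -> 0 < D -> 0 < s ->
  exists2 m, 0 < m & forall U V G P, 0 <= U -> 0 <= V -> 0 <= G ->
    c * U - D * V <= G -> s * V <= P -> m * (U + V) <= G + P.
Proof.
move=> c0 D0 s0; pose th := Num.min 1 (s / (2 * D)).
have th0 : 0 < th by rewrite lt_min ltr01 divr_gt0// mulr_gt0.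
have th1 : th <= 1 by rewrite ge_min lexx.
have thD : th * D <= s / 2.
  have -> : s / 2 = s / (2 * D) * D by field; rewrite gt_eqF.
  by rewrite ler_wpM2r ?(ltW D0)// ge_min lexx orbT.
exists (Num.min (th * c) (s / 2)).
  by rewrite lt_min mulr_gt0//= divr_gt0.
move=> U V G P U0 V0 G0 low pen; set m := Num.min _ _.
have mU : m * U <= th * c * U by rewrite ler_wpM2r// ge_min lexx.
have mV : m * V <= s * V / 2.
  by rewrite [leRHS]mulrAC ler_wpM2r// ge_min lexx orbT.
have thV : th * D * V <= s * V / 2 by rewrite [leRHS]mulrAC ler_wpM2r.
have thlow : th * c * U - th * D * V <= G.
  rewrite -!mulrA -mulrBr; apply: (@le_trans _ _ (th * G)).
    by rewrite ler_wpM2l// ltW.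
  by rewrite ler_piMl.
rewrite mulrDr; apply: le_trans (lerD thlow pen).
move: (m * U) (m * V) (th * c * U) (th * D * V) (s * V) mU mV thV.
by clear => mU mV tU tV sV; lra.
Qed.

Section Aggregate.
Variables (R : realType) (K M : nat) (J : 'I_K -> 'cV[R]_M -> R).
Variables (delta nu : R).
Hypothesis K_gt0 : (0 < K)%N.
Hypothesis J_convex : forall k, convex_function setT (J k).
Hypothesis J_diff : forall k x, differentiable (J k : _ -> R^o) x.
Hypothesis J_smooth : forall k u v,
  enorm (grad (J k) u - grad (J k) v) <= delta * enorm (u - v).
Hypothesis Jbar_strong : forall u v,
  nu * enorm (u - v) ^+ 2 <= dotp (u - v) (grad (Jbar J) u - grad (Jbar J) v).
Hypothesis nu_gt0 : 0 < nu.
Hypothesis delta_gt0 : 0 < delta.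
Implicit Types u v w : 'cV[R]_(K * M).

Lemma gradJ_cocoercive u v :
  dotp (gradJ J u - gradJ J v) (gradJ J u - gradJ J v) <=
    delta * dotp (gradJ J u - gradJ J v) (u - v).
Proof.
rewrite !dotp_blocks mulr_sumr; apply: ler_sum => k _.
rewrite !blockB !block_stack.
exact: grad_cocoercive.
Qed.

Lemma gradJ_monotone u v : 0 <= dotp (gradJ J u - gradJ J v) (u - v).
Proof.
rewrite -(@pmulr_rge0 _ delta)//.
exact: le_trans (dotp_ge0 _) (gradJ_cocoercive u v).
Qed.

Lemma gradJ_lipschitz u v :
  dotp (gradJ J u - gradJ J v) (gradJ J u - gradJ J v) <=
    delta ^+ 2 * dotp (u - v) (u - v).
Proof.
rewrite !dotp_blocks mulr_sumr; apply: ler_sum => k _.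
rewrite !blockB !block_stack.
exact: enorm_le_sqr.
Qed.

(** At consensus points the stacked gradients only enter through their sum, which
    is [K] times the gradient of the mean cost; this cancels the [K] copies in the
    norm of a consensus vector. *)
Lemma gradJ_consensus_strong (a b : 'cV[R]_M) :
  nu * dotp (consensus K (a - b)) (consensus K (a - b)) <=
  dotp (gradJ J (consensus K a) - gradJ J (consensus K b)) (consensus K (a - b)).
Proof.
rewrite !dotp_consensusr.
under eq_bigr do rewrite block_consensus.
under [X in _ <= dotp X _]eq_bigr do
  rewrite blockB !block_stack !block_consensus.
have := Jbar_strong a b; rewrite enorm_sqr dotpC !(grad_Jbar J_diff).
rewrite -scalerBr dotpZl -sumrB ler_pdivlMl ?ltr0n// sumr_const card_ord.
by rewrite -(scaler_nat K (a - b)) dotpZl => h; rewrite mulrCA.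
Qed.

Variables (A : 'M[R]_K) (S : 'M[R]_(K * M)) (smin : R).
Hypothesis A_ds : doubly_stochastic A.
Hypothesis A_prim : primitive A.
Hypothesis S_sqrt : psd_sqrt (Bcal M A) S.
Hypothesis smin_def : smallest_nonzero_singular_value (Bcal M A) smin.
Hypothesis smin_gt0 : 0 < smin.

(** Zero block sum means orthogonality to the consensus space, which is the kernel
    of [B]. *)
Lemma range_Bcal (x : 'cV[R]_(K * M)) :
  \sum_k block k x = 0 -> exists d, x = Bcal M A *m d.
Proof.
move=> x0; apply: symmetric_range (sqr_sym S_sqrt) _ => k.
move=> /(ker_Bcal K_gt0 A_ds A_prim)[a ->].
by rewrite dotp_consensusr x0 dotp0l.
Qed.

(** Split [w - wstar = u + v] into its consensus part [u] and a part [v] in the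
    range of [B]: strong monotonicity of the mean gradient controls [u], the
    penalty [B] controls [v]. *)
Lemma restricted_strong_monotonicity mu (ws : 'cV[R]_M) : 0 < mu ->
  exists2 m, 0 < m & forall w,
    m * dotp (w - consensus K ws) (w - consensus K ws) <=
    dotp (gradJ J w - gradJ J (consensus K ws) +
          mu^-1 *: (Bcal M A *m (w - consensus K ws))) (w - consensus K ws).
Proof.
move=> mu_gt0.
have D0 : 0 < 2 * delta ^+ 2 / nu by rewrite divr_gt0// mulr_gt0// exprn_gt0.
have s0 : 0 < mu^-1 * smin by rewrite mulr_gt0// invr_gt0.
have [m m0 mP] := absorb_deficit (divr_gt0 nu_gt0 (ltr0n _ 2)) D0 s0.
exists m => // w; set wt := w - consensus K ws.
pose a := K%:R^-1 *: \sum_k block k wt; pose u := consensus K a; pose v := wt - u.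
have K0 : K%:R != 0 :> R by rewrite pnatr_eq0 -lt0n.
have v0 : \sum_k block k v = 0.
  under eq_bigr do rewrite blockB block_consensus.
  rewrite sumrB sumr_const card_ord -(scaler_nat K a) scalerA mulfV// scale1r.
  by rewrite subrr.
have wtE : wt = u + v by rewrite addrC subrK.
have uv : dotp u v = 0 by rewrite dotpC dotp_consensusr v0 dotp0l.
have [d vd] := range_Bcal v0.
have Bv : smin * dotp v v <= dotp wt (Bcal M A *m wt).
  have Su : S *m u = 0 by apply: (ker_sqrt S_sqrt); exact: Bcal_consensus.
  rewrite (sqr_form S_sqrt) wtE mulmxDr Su add0r.
  have -> : v = S *m (S *m d) by rewrite mulmxA (sqrt_mul S_sqrt).
  exact: (sqrt_lower S_sqrt (S *m d) smin_def).
pose mid := consensus K (ws + a).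
pose g1 := gradJ J w - gradJ J mid.
pose g0 := gradJ J mid - gradJ J (consensus K ws).
have midE : mid = consensus K ws + u.
  by apply: eq_blocks => k; rewrite blockD !block_consensus.
have dv : w - mid = v by rewrite midE opprD addrA.
have du : mid - consensus K ws = u by rewrite midE addrAC subrr add0r.
have g01 : gradJ J w - gradJ J (consensus K ws) = g1 + g0 by rewrite addrA subrK.
have low : nu / 2 * dotp u u - 2 * delta ^+ 2 / nu * dotp v v <=
    dotp (g1 + g0) wt.
  rewrite wtE; apply: two_scale_bound => //.
  - by rewrite -dv; exact: gradJ_monotone.
  - by have := gradJ_consensus_strong (ws + a) ws; rewrite addrAC subrr add0r.
  - by rewrite -dv; exact: gradJ_lipschitz.
  - by rewrite -du; exact: gradJ_lipschitz.
rewrite g01 dotpDl dotpZl [dotp (_ *m _) _]dotpC.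
have -> : dotp wt wt = dotp u u + dotp v v.
  by rewrite [in LHS]wtE dotpDD uv mulr0 addr0.
apply: mP; rewrite ?dotp_ge0//; first by rewrite -g01; exact: gradJ_monotone.
by rewrite -mulrA ler_pM2l ?invr_gt0.
Qed.

End Aggregate.

(** * Linear convergence *)

(** In the application [q] is the primal error after the gradient step, and [y]
    and [y'] are the dual errors before and after the update. With weight
    [alpha^-1] on the dual errors the terms [<q, S y>] cancel, which leaves
    [- |S y|^2] to contract them. *)
Lemma primal_dual_identity (R : realType) n (S : 'M[R]_n) (alpha : R)
    (q y z y' : 'cV[R]_n) : S^T = S -> alpha != 0 ->
    z = q - S *m y -> y' = y + alpha *: (S *m z) ->
  dotp z z - alpha * dotp (S *m z) (S *m z) + alpha^-1 * dotp y' y' =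
  dotp q q + alpha^-1 * (dotp y y - alpha * dotp (S *m y) (S *m y)).
Proof.
move=> Ssym a0 zE ->.
rewrite [dotp (y + _) _]dotpDD dotpZl !dotpZr.
have -> : dotp y (S *m z) = dotp q (S *m y) - dotp (S *m y) (S *m y).
  by rewrite -{1}Ssym -dotp_mulmx zE dotpBr dotpC [dotp q _]dotpC.
have -> : dotp z z = dotp q q - 2 * dotp q (S *m y) + dotp (S *m y) (S *m y).
  by rewrite zE dotpBB.
by field.
Qed.

(** Cocoercivity bounds the second-order term [mu^2 |g|^2] of the squared distance
    by [mu^2 L <g, x>], a part of the first-order decrease [2 mu <g, x>]; strong
    monotonicity turns the rest into a multiple of [|x|^2]. *)
Lemma gradient_step_contraction (R : realType) n (mu L m : R) (x g : 'cV[R]_n) :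
    0 < mu -> mu * L <= 2 ->
    dotp g g <= L * dotp g x -> m * dotp x x <= dotp g x ->
  dotp (x - mu *: g) (x - mu *: g) <= (1 - mu * m * (2 - mu * L)) * dotp x x.
Proof.
move=> mu0 muL gco gmon.
rewrite dotpBB dotpZl !dotpZr [dotp x g]dotpC.
have h1 : mu * (mu * dotp g g) <= mu * (mu * L) * dotp g x.
  by rewrite -!mulrA !ler_pM2l.
have h2 : mu * (2 - mu * L) * (m * dotp x x) <= mu * (2 - mu * L) * dotp g x.
  by rewrite ler_wpM2l// mulr_ge0 ?subr_ge0// ltW.
have -> : (1 - mu * m * (2 - mu * L)) * dotp x x =
  dotp x x - mu * (2 - mu * L) * (m * dotp x x) by ring.
have e : mu * (2 - mu * L) * dotp g x =
  2 * (mu * dotp g x) - mu * (mu * L) * dotp g x by ring.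
by rewrite e in h2; clear e gco gmon; lra.
Qed.

(** Both bounds come from [alpha * smax < alpha <= t]: [smax < 1] makes the first
    inequality strict. *)
Lemma rate_lt1 (R : realType) (t alpha smax smin : R) :
    0 < alpha -> alpha <= Num.min 1 t -> 0 < smin -> smax < 1 -> 0 < smax ->
  0 < 1 - alpha * smax /\
  Num.max ((1 - t) / (1 - alpha * smax)) (1 - alpha * smin) < 1.
Proof.
move=> a0; rewrite le_min => /andP[a1 at_] s0 s1 sp.
have as_ : alpha * smax < alpha by rewrite gtr_pMr.
have d0 : 0 < 1 - alpha * smax by rewrite subr_gt0 (lt_le_trans as_).
split=> //; rewrite gt_max; apply/andP; split; last first.
  by rewrite gtrBl mulr_gt0.
by rewrite ltr_pdivrMr// mul1r ltrD2l ltrN2 (lt_le_trans as_).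
Qed.

Lemma geometric_decay (R : realType) (gamma : R) (V : nat -> R) : 0 <= gamma ->
  (forall i, V i.+1 <= gamma * V i) -> forall i, V i <= gamma ^+ i * V 0%N.
Proof.
move=> g0 step; elim=> [|i IHi]; first by rewrite expr0 mul1r.
by apply: le_trans (step i) _; rewrite exprS -mulrA ler_wpM2l.
Qed.

Section FixedPoint.
Variables (R : realType) (K M : nat) (J : 'I_K -> 'cV[R]_M -> R).
Variables (r : 'cV[R]_M -> \bar R) (wstar : 'cV[R]_M).
Variables (A : 'M[R]_K) (S : 'M[R]_(K * M)).
Hypothesis K_gt0 : (0 < K)%N.
Hypothesis J_diff : forall k x, differentiable (J k : _ -> R^o) x.
Hypothesis r_proper : proper_ext r.
Hypothesis r_convex : convex_ext r.
Hypothesis wstar_min : argmin (fun w => ((Jbar J w)%:E + r w)%E) wstar.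
Hypothesis A_ds : doubly_stochastic A.
Hypothesis A_prim : primitive A.
Hypothesis S_sqrt : psd_sqrt (Bcal M A) S.

Let ws : 'cV[R]_(K * M) := consensus K wstar.
Let zstar mu : 'cV[R]_(K * M) := consensus K (wstar - mu *: grad (Jbar J) wstar).

(** Fermat's rule at [wstar], repeated in each block. *)
Lemma zstar_subgradient mu : 0 < mu ->
  is_subgradient (@Rcal R K M r) ws (mu^-1 *: (zstar mu - ws)).
Proof.
move=> mu0; apply: Rcal_subgradient => k.
rewrite blockZ blockB !block_consensus addrAC subrr add0r scalerN scalerA.
rewrite mulVf ?gt_eqF// scale1r.
apply: (argmin_subgradient r_proper r_convex (h := Jbar J)) => //.
  by move=> v; have := wstar_min v; rewrite addeC [(_ + r v)%E]addeC.
by move=> d; rewrite (grad_Jbar J_diff); exact: is_derive_Jbar_line.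
Qed.

(** The blocks of [mean gradient - local gradient] sum to zero, so this vector
    lies in the range of [B], hence is [S y] for some [y] in the range of [S]. *)
Lemma dual_fixed_point mu :
  exists d, zstar mu = ws - mu *: gradJ J ws - S *m (S *m d).
Proof.
have K0 : K%:R != 0 :> R by rewrite pnatr_eq0 -lt0n.
have [|d dE] := @range_Bcal _ _ _ K_gt0 _ _ A_ds A_prim S_sqrt
    (ws - mu *: gradJ J ws - zstar mu).
  set gbar := grad (Jbar J) wstar.
  have E k : block k (ws - mu *: gradJ J ws - zstar mu) =
      mu *: (gbar - grad (J k) wstar).
    rewrite !blockB blockZ block_stack !block_consensus -/gbar.
    move: (grad (J k) wstar) gbar => g h.
    by apply/colP => i; rewrite !mxE; ring.
  under eq_bigr do rewrite E.
  rewrite -scaler_sumr sumrB sumr_const card_ord -(scaler_nat K gbar).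
  by rewrite /gbar (grad_Jbar J_diff) scalerA mulfV// scale1r subrr scaler0.
exists d; rewrite mulmxA (sqrt_mul S_sqrt) -dE opprB addrC subrK.
by [].
Qed.

End FixedPoint.

Theorem theorem1 (R : realType) (K M : nat) (K_ge2 : (2 <= K)%N)
    (M_gt0 : (0 < M)%N)
    (J : 'I_K -> 'cV[R]_M -> R) (r : 'cV[R]_M -> \bar R) (delta nu : R)
    (J_convex : forall k, convex_function setT (J k))
    (J_diff : forall k x, differentiable (J k : _ -> R^o) x)
    (J_smooth : forall k u v,
      enorm (grad (J k) u - grad (J k) v) <= delta * enorm (u - v))
    (Jbar_strong : forall u v,
      nu * enorm (u - v) ^+ 2 <=
      dotp (u - v) (grad (Jbar J) u - grad (Jbar J) v))
    (nu_gt0 : 0 < nu) (nu_le_delta : nu <= delta)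
    (r_proper : proper_ext r) (r_lsc : lower_semicontinuous r)
    (r_convex : convex_ext r)
    (wstar : 'cV[R]_M)
    (wstar_min : argmin (fun w => ((Jbar J w)%:E + r w)%E) wstar)
    (A : 'M[R]_K) (A_sym : A^T = A) (A_ds : doubly_stochastic A)
    (A_prim : primitive A)
    (Bh : 'M[R]_(K * M)) (Bh_sqrt : psd_sqrt (Bcal M A) Bh)
    (smax smin : R)
    (smax_def : largest_singular_value (Bcal M A) smax)
    (smin_def : smallest_nonzero_singular_value (Bcal M A) smin)
    (c : R) (c_gt0 : 0 < c) (c_lt : c < nu / (2 * delta))
    (mu : R) (mu_gt0 : 0 < mu) (mu_lt : mu < (1 - smax) / delta) :
  exists rho : R, 0 < rho /\
    let nu_rho := Num.min (nu - 2 * delta * c)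
                    (rho * smin * c ^+ 2 / (4 * (c ^+ 2 + 1))) in
    0 < nu_rho /\
    forall alpha : R, 0 < alpha ->
      alpha <= Num.min 1 (mu * nu_rho * (2 - smax - mu * delta)) ->
      let gamma := Num.max
        ((1 - mu * nu_rho * (2 - smax - mu * delta)) / (1 - alpha * smax))
        (1 - alpha * smin) in
      gamma < 1 /\
      forall w y z : nat -> 'cV[R]_(K * M),
        P2D2 J r Bh mu alpha w y z -> y 0%N = 0 ->
        exists C : R, 0 < C /\
          forall i : nat,
            enorm (w i - tensmx (const_mx 1 : 'cV[R]_K) wstar) ^+ 2 <=
            C * gamma ^+ i.
Proof.
have K_gt0 : (0 < K)%N by exact: leq_trans K_ge2.
have delta_gt0 : 0 < delta by exact: lt_le_trans nu_le_delta.
have [[smin_ge0 smin_eig] smin_neq0 _] := smin_def.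
have smin_gt0 : 0 < smin by rewrite lt_neqAle eq_sym smin_neq0.
have smin_le_smax : smin <= smax by case: smax_def => _; apply.
have smax_gt0 : 0 < smax by exact: lt_le_trans smin_le_smax.
have mu_delta : mu * delta < 1 - smax by rewrite -ltr_pdivlMr.
have smax_lt1 : smax < 1.
  by rewrite -subr_gt0; apply: lt_trans mu_delta; rewrite mulr_gt0.
have [m m_gt0 mP] := restricted_strong_monotonicity K_gt0 J_convex J_diff
  J_smooth Jbar_strong nu_gt0 delta_gt0 A_ds A_prim Bh_sqrt smin_def smin_gt0
  wstar mu_gt0.
have c2_gt0 : 0 < c ^+ 2 by rewrite exprn_gt0.
have c21_gt0 : 0 < c ^+ 2 + 1 by rewrite addr_gt0.
(* this value of [rho] makes the second term of the minimum equal to [m] *)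
exists (4 * (c ^+ 2 + 1) * m / (smin * c ^+ 2)); split.
  by rewrite !(divr_gt0, mulr_gt0).
move=> nu_rho.
have nu_rho_m : nu_rho <= m.
  rewrite /nu_rho ge_min; apply/orP; right.
  rewrite le_eqVlt; apply/orP; left; apply/eqP; field.
  by rewrite !gt_eqF.
have nu_rho_gt0 : 0 < nu_rho.
  rewrite /nu_rho lt_min; apply/andP; split.
    move: c_lt; rewrite ltr_pdivlMr ?mulr_gt0// subr_gt0.
    by rewrite [c * _]mulrC.
  by rewrite !(divr_gt0, mulr_gt0).
clearbody nu_rho; split=> // alpha alpha_gt0 alpha_le gamma.
have [den_gt0 gamma_lt1] :=
  rate_lt1 alpha_gt0 alpha_le smin_gt0 smax_lt1 smax_gt0.
split=> // w y z rec y0.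
have num_le : (1 - mu * nu_rho * (2 - smax - mu * delta)) <=
    gamma * (1 - alpha * smax).
  by rewrite -ler_pdivrMr// /gamma le_max lexx.
have smin_le : 1 - alpha * smin <= gamma by rewrite /gamma le_max lexx orbT.
have gamma_ge0 : 0 <= gamma.
  apply: le_trans smin_le; apply: le_trans (ltW den_gt0) _.
  by rewrite lerD2l lerN2 ler_pM2l.
clearbody gamma.
pose ws : 'cV[R]_(K * M) := consensus K wstar.
pose zs : 'cV[R]_(K * M) := consensus K (wstar - mu *: grad (Jbar J) wstar).
have [d zsE] : exists d, zs = ws - mu *: gradJ J ws - Bh *m (Bh *m d).
  exact: (dual_fixed_point wstar K_gt0 J_diff A_ds A_prim Bh_sqrt mu).
pose ys := Bh *m d.
have Bcons a : Bh *m consensus K a = 0.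
  by apply: (ker_sqrt Bh_sqrt); exact: Bcal_consensus.
have zs_sub : is_subgradient (@Rcal R K M r) ws (mu^-1 *: (zs - ws)).
  exact: (zstar_subgradient J_diff r_proper r_convex wstar_min mu_gt0).
pose V i := (1 - alpha * smax) * dotp (w i - ws) (w i - ws) +
  alpha^-1 * dotp (y i - ys) (y i - ys).
have y_range i : exists e, y i - ys = Bh *m e.
  elim: i => [|i [e ye]].
    by exists (- d); rewrite y0 sub0r mulmxN.
  have [_ -> _] := rec i; exists (e + alpha *: z i.+1).
  by rewrite addrAC ye mulmxDr scalemxAr.
have step i : V i.+1 <= gamma * V i.
  have [zE yE wE] := rec i.
  pose wt := w i - ws; pose yt := y i - ys; pose zt := z i.+1 - zs.
  pose g := gradJ J (w i) - gradJ J ws + mu^-1 *: (Bcal M A *m wt).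
  have ztE : zt = (wt - mu *: g) - Bh *m yt.
    rewrite /zt zE zsE (grad_Jmu J_diff _ _ Bh_sqrt) /g /wt mulmxBr.
    rewrite [Bcal M A *m ws]Bcal_consensus// subr0 /yt mulmxBr -/ys.
    by apply/colP => j; rewrite !mxE; field; rewrite gt_eqF.
  have ytE : y i.+1 - ys = yt + alpha *: (Bh *m zt).
    by rewrite yE /zt mulmxBr [Bh *m zs]Bcons subr0 addrAC.
  have prim : dotp (w i.+1 - ws) (w i.+1 - ws) <= dotp zt zt.
    apply: (subgradient_nonexpansive mu_gt0 _ zs_sub).
    apply: (prox_subgradient _ _ mu_gt0 wE).
      exact: Rcal_proper.
    exact: Rcal_convex.
  have grad_step : dotp (wt - mu *: g) (wt - mu *: g) <=
      (1 - mu * nu_rho * (2 - smax - mu * delta)) * dotp wt wt.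
    have muL : mu * (delta + smax / mu) = mu * delta + smax.
      by rewrite mulrDr; congr (_ + _); rewrite mulrC divfK// gt_eqF.
    have -> : 2 - smax - mu * delta = 2 - mu * (delta + smax / mu).
      by rewrite muL; ring.
    apply: gradient_step_contraction => //.
    - by rewrite muL; lra.
    - apply: cocoerciveD => //; first by rewrite divr_gt0.
        exact: gradJ_cocoercive.
      rewrite !dotpZl dotpZr.
      have -> : smax / mu * (mu^-1 * dotp (Bcal M A *m wt) wt) =
          mu^-1 * (mu^-1 * (smax * dotp (Bh *m wt) (Bh *m wt))).
        by rewrite [dotp (_ *m wt) wt]dotpC (sqr_form Bh_sqrt); ring.
      rewrite !ler_pM2l ?invr_gt0// -(sqrt_mul Bh_sqrt) -mulmxA.
      exact: (sqrt_upper Bh_sqrt (Bh *m wt) smax_def).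
    - apply: le_trans (mP (w i)).
      by rewrite ler_wpM2r ?dotp_ge0.
  have dual : dotp yt yt - alpha * dotp (Bh *m yt) (Bh *m yt) <=
      (1 - alpha * smin) * dotp yt yt.
    have [e yte] := y_range i.
    rewrite mulrBl mul1r lerD2l lerN2 -mulrA ler_pM2l// /yt yte.
    exact: (sqrt_lower Bh_sqrt e smin_def).
  have energy := primal_dual_identity (sqrt_sym Bh_sqrt) (lt0r_neq0 alpha_gt0)
    ztE ytE.
  have upper := sqrt_upper Bh_sqrt zt smax_def.
  have -> : gamma * V i = gamma * (1 - alpha * smax) * dotp wt wt +
      alpha^-1 * (gamma * dotp yt yt) by rewrite /V; ring.
  apply: (@le_trans _ _ (dotp zt zt - alpha * dotp (Bh *m zt) (Bh *m zt) +
      alpha^-1 * dotp (y i.+1 - ys) (y i.+1 - ys))).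
    rewrite /V lerD2r; apply: (@le_trans _ _ ((1 - alpha * smax) * dotp zt zt)).
      by rewrite ler_pM2l.
    by rewrite mulrBl mul1r lerD2l lerN2 -mulrA ler_pM2l.
  rewrite energy; apply: lerD.
    apply: le_trans grad_step _.
    by rewrite ler_wpM2r ?dotp_ge0.
  rewrite ler_pM2l ?invr_gt0//; apply: le_trans dual _.
  by rewrite ler_wpM2r ?dotp_ge0.
have V_ge0 i : (1 - alpha * smax) * dotp (w i - ws) (w i - ws) <= V i.
  by rewrite lerDl mulr_ge0 ?dotp_ge0// invr_ge0 ltW.
exists (V 0%N / (1 - alpha * smax) + 1); split.
  rewrite ltr_wpDl// divr_ge0 ?(ltW den_gt0)//; apply: le_trans (V_ge0 0%N).
  by rewrite mulr_ge0 ?dotp_ge0 ?(ltW den_gt0).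
move=> i; rewrite enorm_sqr; apply: (@le_trans _ _ (V i / (1 - alpha * smax))).
  by rewrite ler_pdivlMr// mulrC.
rewrite [leRHS]mulrDl mul1r.
apply: (@le_trans _ _ (V 0%N / (1 - alpha * smax) * gamma ^+ i)).
  rewrite mulrAC ler_pM2r ?invr_gt0// mulrC.
  exact: (geometric_decay gamma_ge0 step).
by rewrite lerDl exprn_ge0.
Qed.
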